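(* Thompson's group $F$ is autostackable. Moreover, with $A=\{x^{\pm1},y^{\pm1}\}$, the following set $R\subseteq A^*\times A^*$ (rules written $u\to v$) is a bounded regular convergent prefix-rewriting system for $F$: \begin{eqnarray*} R &=& \bigcup_{a \in A} \left\{uaa^{-1} \to u \mid u \in A^*\right\}\\ &&\cup \bigcup_{\epsilon\in\{1,-1\}} \bigcup_{i \in \{1,2\}}\left\{uy^\epsilon x^iy \to ux^{i}yx^{-i-1}y^{\epsilon}x^{i+1} \mid uy^\epsilon x^i \in \mathcal N\right\}\\ &&\cup \bigcup_{\epsilon\in\{1,-1\}} \bigcup_{i \in \{2,3\}}\left\{uy^\epsilon x^iy^{-1} \to ux^{i}y^{-1}x^{-i+1}y^{\epsilon}x^{i-1} \mid uy^\epsilon x^i \in \mathcal N\right\}\\ &&\cup \left\{uxy \to uy^{-1}xyx^{-2}yx^2 \mid u \in \mathcal N \cap (A^*y^{\pm 1}A^*x^2)\right\}\\ &&\cup \left\{ux^2y^{-1} \to u y^{-1}x^2y^{-1}x^{-1}yx \mid u \in \mathcal N \cap (A^*y^{\pm 1}A^*x^2)\right\}. \end{eqnarray*}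
   Context: Thompson's group $F$ is given by the presentation $F=\langle x,y \mid [y,xyx^{-2}],[y,x^2yx^{-3}]\rangle$, and $A=\{x^{\pm1},y^{\pm1}\}$; $A^*$ is the set of all finite words over $A$. The set $\mathcal N\subseteq A^*$ is the set of all words over $A$ that contain no subword of the form $aa^{-1}$ ($a\in A$), nor $y^\epsilon x^i y$, nor $y^\epsilon x^{i+1}y^{-1}$, for any $\epsilon\in\{1,-1\}$ and integer $i\ge 1$. For a set $S$ of words, $A^*y^{\pm1}A^*x^2$ denotes the set of words of the form $w_1 y^{\delta} w_2 x^2$ with $w_1,w_2\in A^*$, $\delta\in\{1,-1\}$. A convergent prefix-rewriting system (CP-RS) for a group $G$ with finite generating set $A$ is a set $R\subseteq A^*\times A^*$ such that $G$ is presented as a monoid by $\langle A\mid u=v\ ((u,v)\in R)\rangle$, and the rewritings $uz\to vz$ for $(u,v)\in R$, $z\in A^*$ satisfy: (termination) there is no infinite sequence of rewritings, and (confluence) the set of words to which no rewriting applies is a set of unique normal forms for $G$. It is bounded if there is $K>0$ such that every $(u,v)\in R$ can be written $(u,v)=(wu',wv')$ with $w,u',v'\in A^*$ and $|u'|+|v'|\le K$. It is regular if $R$ is synchronously regular, i.e. the set of padded words $\hat w$ for $w\in R$ (pad the shorter word with a new symbol $\$$ and read the pair letter by letter over the alphabet $(A\cup\{\$\})^2$) is accepted by a finite state automaton. A group is autostackable if it admits a bounded regular CP-RS over some finite generating set. *)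

(* Defs.v *)
From HB Require Import structures.
From Stdlib Require Import Relations.
From mathcomp Require Import all_boot.

Set Implicit Arguments.
Unset Strict Implicit.
Unset Printing Implicit Defensive.

Section Generic.
Variable B : Type.

Definition cong_step (r : seq B -> seq B -> Prop) (s t : seq B) : Prop :=
  exists p q u v, r u v /\ s = p ++ u ++ q /\ t = p ++ v ++ q.

Definition congr (r : seq B -> seq B -> Prop) : seq B -> seq B -> Prop :=
  clos_refl_sym_trans (seq B) (cong_step r).

Definition prewrite (R : seq B -> seq B -> Prop) (s t : seq B) : Prop :=
  exists u v z, R u v /\ s = u ++ z /\ t = v ++ z.

Definition irreducible (R : seq B -> seq B -> Prop) (w : seq B) : Prop :=
  forall t, ~ prewrite R w t.

Definition terminating (R : seq B -> seq B -> Prop) : Prop :=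
  ~ exists f : nat -> seq B, forall n, prewrite R (f n) (f n.+1).

Definition bounded_rs (R : seq B -> seq B -> Prop) : Prop :=
  exists K : nat, forall u v, R u v ->
    exists w u' v', u = w ++ u' /\ v = w ++ v' /\ size u' + size v' <= K.

(* padded word of a pair: pad the shorter word with $ (= None) *)
Definition pad (u v : seq B) : seq (option B * option B) :=
  [seq (onth u i, onth v i) | i <- iota 0 (maxn (size u) (size v))].

End Generic.

Record dfa (S : Type) := Dfa {
  dfa_state : finType;
  dfa_start : dfa_state;
  dfa_final : dfa_state -> bool;
  dfa_trans : dfa_state -> S -> dfa_state }.

Definition dfa_accepts (S : Type) (D : dfa S) (s : seq S) : bool :=
  @dfa_final S D (foldl (@dfa_trans S D) (@dfa_start S D) s).

Definition sync_regular (B : Type) (R : seq B -> seq B -> Prop) : Prop :=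
  exists D : dfa (option B * option B),
    forall s, dfa_accepts D s <-> exists u v, R u v /\ s = pad u v.

(* Thompson's group F = < x, y | [y, x y x^-2], [y, x^2 y x^-3] >      *)

Inductive letter := lx | lX | ly | lY.

Definition letter_code (a : letter) : 'I_4 :=
  match a with lx => inord 0 | lX => inord 1 | ly => inord 2 | lY => inord 3 end.
Definition letter_decode (i : 'I_4) : letter :=
  match val i with 0 => lx | 1 => lX | 2 => ly | _ => lY end.
Lemma letter_codeK : cancel letter_code letter_decode.
Proof. by case; rewrite /letter_decode /= inordK. Qed.
HB.instance Definition _ := Finite.copy letter (can_type letter_codeK).

Definition linv (a : letter) : letter :=
  match a with lx => lX | lX => lx | ly => lY | lY => ly end.

Definition winv (w : seq letter) : seq letter := rev (map linv w).

Definition commw (a b : seq letter) : seq letter := winv a ++ winv b ++ a ++ b.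

Definition xpow (n : nat) : seq letter := nseq n lx.
Definition Xpow (n : nat) : seq letter := nseq n lX.

Definition relator1 : seq letter := commw [:: ly] ([:: lx; ly] ++ Xpow 2).
Definition relator2 : seq letter := commw [:: ly] (xpow 2 ++ [:: ly] ++ Xpow 3).

Definition F_rel (u v : seq letter) : Prop :=
  v = [::] /\ ((exists a, u = [:: a; linv a]) \/ u = relator1 \/ u = relator2).

Definition Feq : seq letter -> seq letter -> Prop := congr F_rel.

(* Convergent prefix-rewriting systems for F over a finite gen. set B, *)
(* given by a map ev : B -> A^* naming the element of F of each letter *)

Definition evw (B : Type) (ev : B -> seq letter) (w : seq B) : seq letter :=
  flatten (map ev w).

Definition presents_F (B : Type) (ev : B -> seq letter)
    (R : seq B -> seq B -> Prop) : Prop :=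
  (forall g : seq letter, exists w : seq B, Feq (evw ev w) g) /\
  (forall w w' : seq B, congr R w w' <-> Feq (evw ev w) (evw ev w')).

Definition unique_normal_forms_F (B : Type) (ev : B -> seq letter)
    (R : seq B -> seq B -> Prop) : Prop :=
  forall g : seq letter, exists w : seq B,
    [/\ irreducible R w, Feq (evw ev w) g &
        forall w', irreducible R w' -> Feq (evw ev w') g -> w' = w].

Definition CPRS_F (B : Type) (ev : B -> seq letter)
    (R : seq B -> seq B -> Prop) : Prop :=
  [/\ presents_F ev R, terminating R & unique_normal_forms_F ev R].

Definition bounded_regular_CPRS_F (B : Type) (ev : B -> seq letter)
    (R : seq B -> seq B -> Prop) : Prop :=
  [/\ CPRS_F ev R, bounded_rs R & sync_regular R].

Definition F_autostackable : Prop :=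
  exists (B : finType) (ev : B -> seq letter) (R : seq B -> seq B -> Prop),
    bounded_regular_CPRS_F ev R.

Definition subword (s w : seq letter) : Prop := exists p q, w = p ++ s ++ q.

Definition yeps (e : bool) : letter := if e then ly else lY.

Definition inN (w : seq letter) : Prop :=
  (forall a, ~ subword [:: a; linv a] w) /\
  (forall e i, 1 <= i -> ~ subword ([:: yeps e] ++ xpow i ++ [:: ly]) w) /\
  (forall e i, 1 <= i -> ~ subword ([:: yeps e] ++ xpow i.+1 ++ [:: lY]) w).

Definition in_AyAx2 (u : seq letter) : Prop :=
  exists w1 w2 e, u = w1 ++ [:: yeps e] ++ w2 ++ xpow 2.

Definition R_F (l r : seq letter) : Prop :=
  (exists u a, l = u ++ [:: a; linv a] /\ r = u) \/
  (exists u e i, ((i == 1) || (i == 2)) /\ inN (u ++ [:: yeps e] ++ xpow i) /\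
     l = u ++ [:: yeps e] ++ xpow i ++ [:: ly] /\
     r = u ++ xpow i ++ [:: ly] ++ Xpow i.+1 ++ [:: yeps e] ++ xpow i.+1) \/
  (exists u e i, ((i == 2) || (i == 3)) /\ inN (u ++ [:: yeps e] ++ xpow i) /\
     l = u ++ [:: yeps e] ++ xpow i ++ [:: lY] /\
     r = u ++ xpow i ++ [:: lY] ++ Xpow i.-1 ++ [:: yeps e] ++ xpow i.-1) \/
  (exists u, inN u /\ in_AyAx2 u /\
     l = u ++ [:: lx; ly] /\
     r = u ++ [:: lY; lx; ly] ++ Xpow 2 ++ [:: ly] ++ xpow 2) \/
  (exists u, inN u /\ in_AyAx2 u /\
     l = u ++ xpow 2 ++ [:: lY] /\
     r = u ++ [:: lY] ++ xpow 2 ++ [:: lY; lX; ly; lx]).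

(* Main.v *)
(* Write z_m = x^-m y x^m.  In F, z_k^-1 z_m z_k = z_{m+1} for k < m, so a word
   z_m^e z_k with k < m, or z_m^e z_k^-1 with k < m - 1, can be sorted by moving
   the right factor to the left; insertion sort makes F act on pairs of a sorted
   freely reduced word and a power of x, and a word of N can be recovered from
   the image of the trivial pair.  Hence words of N are unique normal forms.

   A rule of R other than a free reduction replaces a letter y or y^-1, whose
   insertion hops over letters with index gaps g_1, g_2, and so on, by letters
   whose insertions are cheaper: the sum of the terms 2 g_i - 1 (2 g_i - 3 for
   y^-1) over the letters hopped over strictly decreases.  Weighting each letter
   by 16 to this power gives termination of prefix-rewriting. *)
Require Import Defs.
From Stdlib Require Import Relations.
From HB Require Import structures.
From mathcomp Require Import all_boot all_order all_algebra zify.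
Import GRing.Theory.
Set Implicit Arguments.
Unset Strict Implicit.
Unset Printing Implicit Defensive.
Local Open Scope ring_scope.

(** * Insertion into sorted words *)

(* [(m, e)] stands for [z_m] if [e] is true and for [z_m^-1] otherwise. *)
Definition zgen := (int * bool)%type.

Definition zinv (c : zgen) : zgen := (c.1, ~~ c.2).

Definition hops (c d : zgen) : bool :=
  if c.2 then c.1 < d.1 else c.1 + 1 < d.1.

(* The letter [d'] with [d c = c d'] in F, provided that [hops c d]. *)
Definition zconj (c d : zgen) : zgen :=
  (if c.2 then d.1 + 1 else d.1 - 1, d.2).

(* Words over the [z_m] are stored with their last letter first. *)
Fixpoint ins (w : seq zgen) (c : zgen) : seq zgen :=
  if w is d :: p then
    if hops c d then zconj c d :: ins p c
    else if d == zinv c then p else c :: w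
  else [:: c].

Definition reduced : seq zgen -> bool :=
  sorted (fun c d => (d != zinv c) && ~~ hops c d).

Ltac zlia :=
  unfold reduced, hops, zconj, zinv in *; simpl in *;
  repeat match goal with
  | H : context [(_, _) == (_, _)] |- _ => rewrite xpair_eqE /= in H
  end;
  rewrite ?xpair_eqE /=; lia.

(** All letters hopped over are shifted by the same amount, so their mutual gaps survive. Only the
    place where the insertion stops matters: there the shifted [d] meets [c] itself or, after a
    cancellation, the letter below the cancelled one. *)
Lemma reduced_ins_cons w c d :
  reduced (d :: w) -> hops c d -> reduced (zconj c d :: ins w c).
Proof.
elim: w d => [|e w IH] d /=.
  by case: c d => k [] [m f]; case: f; zlia.
case/andP=> de rw cd; case: ifP => ce.
  rewrite /=; apply/andP; split; last exact: IH.
  by case: c d e cd de ce {IH rw} => k [] [m []] [l []]; zlia.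
case: ifP => eqe.
  case: w {IH} rw => [|f w] //= /andP[ef ->]; rewrite andbT.
  rewrite (eqP eqe) in ef.
  by case: c d f {e ce eqe de} ef cd => k [] [m []] [l []]; zlia.
rewrite /= rw.
by case: c d e cd de ce eqe {IH rw} => k [] [m []] [l []]; zlia.
Qed.

Lemma reduced_ins w c : reduced w -> reduced (ins w c).
Proof.
case: w => [|d w] //= rw; case: ifP => cd; first exact: reduced_ins_cons.
case: ifP => eqd; first exact: path_sorted rw.
by rewrite /= cd eqd.
Qed.

Lemma ins_reduced w c : reduced (c :: w) -> ins w c = c :: w.
Proof. by case: w => //= d w /andP[/andP[/negPf -> /negPf ->]]. Qed.

Lemma zinvK : involutive zinv.
Proof. by case=> k b; rewrite /zinv /= negbK. Qed.

Lemma reduced_behead c w : reduced (c :: w) -> reduced w.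
Proof. exact: path_sorted. Qed.

(** [z_k] passes [z_m] exactly when [z_k^-1] passes [z_{m+1}], so the second insertion retraces the
    first and undoes each shift. Where the first one stopped, it cancels the new letter or restores
    the cancelled one. *)
Lemma insK w c : reduced w -> ins (ins w c) (zinv c) = w.
Proof.
elim: w => [_|d w IH rw] /=; first by rewrite zinvK eqxx ifN //; case: c => k []; zlia.
have rw' := reduced_behead rw.
case: ifP => cd /=.
  rewrite IH //.
  have -> : hops (zinv c) (zconj c d) by case: c d cd {IH rw} => k [] [m f]; zlia.
  by case: c d {cd IH rw} => k [] [m f]; rewrite /zconj /= ?addrK ?subrK.
case: ifP => [/eqP eqd|_] /=; first by rewrite -eqd ins_reduced.
by rewrite zinvK eqxx ifN //; case: c {cd IH rw} => k []; zlia.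
Qed.

(** This is the relation [z_m^e z_k = z_k z_{m+1}^e], read as an identity between insertions; it is
    what makes insertion an action of F. *)
Lemma ins_comm w (k : int) a : reduced w -> k < a.1 ->
  ins (ins w a) (k, true) = ins (ins w (k, true)) (a.1 + 1, a.2).
Proof.
elim: w => [|d w IH] rw ka.
  by case: a ka => m [] /= ka; rewrite /= ifT ?ifN ?ifN //; zlia.
have rw' := reduced_behead rw.
rewrite /=; case: ifP => ad.
  have kd : hops (k, true) d by case: a ad ka {IH} => m []; zlia.
  rewrite kd /= !ifT.
  - rewrite IH //; case: a d {IH rw ad ka kd} => m [] [l f];
      by rewrite /zconj /=; congr ((_, _) :: _); lia.
  - by case: a d ad {IH rw ka} kd => m [] [l f]; zlia.
  - by case: a d ad {IH rw} kd ka => m [] [l f]; zlia.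
case: ifP => eqd.
  rewrite (eqP eqd) in rw *.
  rewrite ifT //= ifN ?ifT //.
  by case: a {IH rw ka ad eqd} => m []; zlia.
have ha : hops (k, true) a by [].
rewrite -[if hops _ d then _ else _]/(ins (d :: w) (k, true)).
(* Here [a] stays on top. Hopping over it leaves a reduced word with the shifted [a] on top, so on
   the right-hand side inserting the shifted [a] merely pushes it. *)
have ra : reduced (a :: d :: w) by rewrite /= ad eqd.
have ins_a := ins_reduced (reduced_ins_cons ra ha).
by rewrite -[(a.1 + 1, _)]/(zconj (k, true) a) ins_a /= ha.
Qed.

(** * The number measuring an insertion *)

(** The least gap allowing a hop is 1 for [z_k] and 2 for [z_k^-1]. The offsets 1 and 3 make this
    cheapest hop cost 1 in both cases, and each further unit of gap costs 2. *)
Fixpoint effort (w : seq zgen) (c : zgen) : nat :=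
  if w is d :: p then
    if hops c d then (absz (d.1 - c.1)%R * 2 - (if c.2 then 1 else 3) + effort p c)%N
    else 0%N
  else 0%N.

Lemma effort_reduced w c : reduced (c :: w) -> effort w c = 0%N.
Proof. by case: w => //= d w /andP[/andP[_ /negPf ->]]. Qed.

(* The rule [x y -> y^-1 x y x^-2 y x^2] replaces the insertion of [z_k] by those
   of [z_{k+1}^-1], [z_k] and [z_{k+2}]. *)
Lemma effort_conj_inv w (k : int) :
  (effort w ((k + 1)%R, false) <= effort w (k, true))%N.
Proof. by elim: w => //= -[m e] w IH; do 2?case: ifP; zlia. Qed.

(** A letter hopped by [z_{k+1}^-1] has moved closer to [z_k] and costs less. The extra 1 pays for
    [z_{k+1}^-1] itself, which [z_k] hops over at gap 1 if it remained in the word. *)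
Lemma effort_conj_mid w (k : int) :
  (effort (ins w ((k + 1)%R, false)) (k, true) <= (effort w (k, true)).+1)%N.
Proof.
elim: w => [|[m e] w IH] /=; first by case: ifP; zlia.
by case: ifP => /=; [|case: ifP => /=]; do ?case: ifP; zlia.
Qed.

(** Letters hopped by the first two insertions are back at their old index, two units closer to
    [z_{k+2}] than to [z_k]. If [z_{k+1}^-1] remained in the word, [z_k] has turned it into
    [z_{k+2}^-1], where the last insertion stops. *)
Lemma effort_conj_last w (k : int) : reduced w ->
  (effort (ins (ins w ((k + 1)%R, false)) (k, true)) ((k + 2)%R, true)
     <= effort w (k, true))%N.
Proof.
elim: w => [_|d w IH rw] /=; first by rewrite ifT /= ?ifN //; zlia.
have {}IH := IH (reduced_behead rw).
case: ifP => hd /=.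
  by case: d hd {rw} => m e hd; rewrite !ifT /=; do ?case: ifP; zlia.
case: ifP => [/eqP ed|_].
  have hc : hops (k, true) d by rewrite ed; zlia.
  have := reduced_ins_cons rw hc; rewrite ed /zconj /= -addrA => r.
  by rewrite effort_reduced.
rewrite [ins _ _]/=; have -> : hops (k, true) (k + 1, false) by zlia.
by rewrite [effort (_ :: _) _]/= ifN //; zlia.
Qed.

(* The rule [x^2 y^-1 -> y^-1 x^2 y^-1 x^-1 y x] replaces the insertion of
   [z_k^-1] by those of [z_{k+2}^-1], [z_k^-1] and [z_{k+1}]. *)
Lemma effort_conjV_inv w (k : int) :
  (effort w ((k + 2)%R, false) <= effort w (k, false))%N.
Proof. by elim: w => //= -[m e] w IH; do 2?case: ifP; zlia. Qed.

(** The extra 1 is the cost of [z_k^-1] hopping over [z_{k+2}^-1] at gap 2. *)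
Lemma effort_conjV_mid w (k : int) :
  (effort (ins w ((k + 2)%R, false)) (k, false) <= (effort w (k, false)).+1)%N.
Proof.
elim: w => [|[m e] w IH] /=; first by case: ifP; zlia.
by case: ifP => /=; [|case: ifP => /=]; do ?case: ifP; zlia.
Qed.

Lemma effort_conjV_last w (k : int) : reduced w ->
  (effort (ins (ins w ((k + 2)%R, false)) (k, false)) ((k + 1)%R, true)
     <= effort w (k, false))%N.
Proof.
elim: w => [_|d w IH rw] /=; first by rewrite ifT /= ?ifN //; zlia.
have {}IH := IH (reduced_behead rw).
case: ifP => hd /=.
  by case: d hd {rw} => m e hd; rewrite !ifT /=; do ?case: ifP; zlia.
case: ifP => [/eqP ed|_].
  have hc : hops (k, false) d by rewrite ed; zlia.
  have := reduced_ins_cons rw hc; rewrite ed /zconj /=.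
  have -> : (k + 2 - 1 = k + 1)%R by lia.
  by move=> r; rewrite effort_reduced.
rewrite [ins _ _]/=; have -> : hops (k, false) (k + 2, false) by zlia.
by rewrite [effort (_ :: _) _]/= ifN //; zlia.
Qed.

(** * The action of F on sorted words *)

(* [(w, k)] stands for the element [w x^-k] of F. *)
Definition state := (seq zgen * int)%type.

Definition act (s : state) (a : letter) : state :=
  match a with
  | lx => (s.1, s.2 - 1)%R
  | lX => (s.1, s.2 + 1)%R
  | ly => (ins s.1 (s.2, true), s.2)
  | lY => (ins s.1 (s.2, false), s.2)
  end.

Definition acts (s : state) (u : seq letter) : state := foldl act s u.

Definition origin : state := ([::], 0).

Definition st (u : seq letter) : state := acts origin u.

Lemma acts_cat s u v : acts s (u ++ v) = acts (acts s u) v.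
Proof. exact: foldl_cat. Qed.

Lemma act_yeps s e : act s (yeps e) = (ins s.1 (s.2, e), s.2).
Proof. by case: e. Qed.

Lemma acts_xpow s i : acts s (xpow i) = (s.1, s.2 - i%:Z)%R.
Proof.
elim: i s => [|i IH] [w k] /=; first by rewrite subr0.
by rewrite -/(xpow i) IH /=; congr (_, _); lia.
Qed.

Lemma reduced_acts s u : reduced s.1 -> reduced (acts s u).1.
Proof. by elim: u s => //= a u IH s rs; apply: IH; case: a => //=; exact: reduced_ins. Qed.

Lemma reduced_st u : reduced (st u).1.
Proof. exact: reduced_acts. Qed.

Lemma actK s a : reduced s.1 -> act (act s a) (linv a) = s.
Proof.
case: s => w k rw; case: a; rewrite /= ?subrK ?addrK //.
  by rewrite -[(k, false)]/(zinv (k, true)) insK.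
by rewrite -[(k, true)]/(zinv (k, false)) insK.
Qed.

(** The two relators act in this way, with [m = k - 2] and [m = k - 3]. By [ins_comm] the last two
    insertions become those of [z_m] and then [z_k], which undo the first two in reverse order. *)
Lemma ins_commutator w (k m : int) : reduced w -> m < k - 1 ->
  ins (ins (ins (ins w (k, false)) (m, false)) (k - 1, true)) (m, true) = w.
Proof.
move=> rw mk; rewrite ins_comm ?reduced_ins //= subrK.
rewrite -[(m, true)]/(zinv (m, false)) insK ?reduced_ins //.
by rewrite -[(k, true)]/(zinv (k, false)) insK.
Qed.

Lemma acts_F_rel s u v : F_rel u v -> reduced s.1 -> acts s u = acts s v.
Proof.
move=> [-> [[a ->] rs|ruv rs]]; first exact: actK.
case: s rs => w k /= rw.
by case: ruv => ->; rewrite /acts /= !subrK; rewrite ins_commutator //; lia.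
Qed.

Lemma st_Feq u v : Feq u v -> st u = st v.
Proof.
elim=> {u v} [_ _ [p [q [u [v [ruv [-> ->]]]]]]||u v _ ->|u v w _ -> _ ->] //.
by rewrite /st !acts_cat (acts_F_rel ruv) ?reduced_acts.
Qed.

(** * Words of N are determined by their action *)

Lemma inN_cat u v : inN (u ++ v) -> inN u.
Proof.
case=> Ninv [Ny NY]; split=> [a [p [q eu]]|]; last split=> e i i0 [p [q eu]].
- by apply: (Ninv a); exists p, (q ++ v); rewrite eu -!catA.
- by apply: (Ny e i i0); exists p, (q ++ v); rewrite eu -!catA.
- by apply: (NY e i i0); exists p, (q ++ v); rewrite eu -!catA.
Qed.

Lemma inN_rcons u a : inN (rcons u a) -> inN u.
Proof. by rewrite -cats1; exact: inN_cat. Qed.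

Lemma linv_yeps e : linv (yeps e) = yeps (~~ e).
Proof. by case: e. Qed.

(* [x ^ (-k)] *)
Definition xword (k : int) : seq letter :=
  match k with Posz j => Xpow j | Negz j => xpow j.+1 end.

Definition base (w : seq zgen) : int := if w is c :: _ then c.1 else 0%R.

(** Spells the element [w x^(-base w)]: expanding [z_m = x^-m y x^m] and merging the powers of [x]
    between neighbours leaves only differences of indices. *)
Fixpoint ypart (w : seq zgen) : seq letter :=
  if w is c :: p then ypart p ++ xword (c.1 - base p) ++ [:: yeps c.2]
  else [::].

Definition nfword (s : state) : seq letter :=
  ypart s.1 ++ xword (s.2 - base s.1).

Lemma rcons_nseq T n (x : T) : rcons (nseq n x) x = nseq n.+1 x.
Proof. by rewrite -cats1 -[[:: x]]/(nseq 1 x) -nseqD addn1. Qed.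

Lemma xwordB1 k :
  xword (k - 1) = rcons (xword k) lx \/ xword k = rcons (xword (k - 1)) lX.
Proof.
case: k => [[|j]|j]; [by left | right | left].
- have -> : (j.+1%:Z - 1 = j%:Z)%R by lia.
  by rewrite /= rcons_nseq.
- have -> : (Negz j - 1 = Negz j.+1)%R by lia.
  by rewrite /= rcons_nseq.
Qed.

Lemma xwordD1 k :
  xword (k + 1) = rcons (xword k) lX \/ xword k = rcons (xword (k + 1)) lx.
Proof. by case: (xwordB1 (k + 1)); rewrite addrK; [right | left]. Qed.

Lemma inN_rcons_linv u a : ~ inN (rcons (rcons u a) (linv a)).
Proof. by case=> N _; apply: (N a); exists u, [::]; rewrite -!cats1 -catA. Qed.

Lemma nfword_yeps w k e :
  nfword ((k, e) :: w, k) = rcons (nfword (w, k)) (yeps e).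
Proof. by rewrite /nfword /= subrr cats0 -cats1 -!catA. Qed.

(** Neighbours [z_m^f z_k^e] are spelled [y^f x^(m-k) y^e]. The forbidden subwords of N are thus the
    spellings of pairs that can be hopped or, for [m = k], cancelled. *)
Lemma reduced_inN_nfword w k e : reduced w ->
  inN (rcons (nfword (w, k)) (yeps e)) -> reduced ((k, e) :: w).
Proof.
case: w => [|[m f] w] //= rw; rewrite /nfword /= => uN; rewrite rw andbT.
apply/andP; split; apply/negP.
  case/eqP => em ef; subst m f.
  apply: (@inN_rcons_linv (ypart w ++ xword (k - base w)) (yeps (~~ e))).
  by rewrite linv_yeps negbK; move: uN; rewrite subrr cats0 -cats1 -!catA /= -!cats1 -!catA.
case: (uN) => _ [Ny NY]; rewrite /hops /=.
case: e {uN} Ny NY => Ny NY hk.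
  have [j ej] : exists j, (k - m = Negz j)%R by exists `|m - k|.-1%N; lia.
  apply: (Ny f j.+1) => //; exists (ypart w ++ xword (m - base w)), [::].
  by rewrite ej -cats1 -!catA.
(* [Negz j.+1] is [-(j + 2)], so the spelling contains [x^(j+2)], the forbidden [x^(i+1)] with
   [i = j + 1]. *)
have [j ej] : exists j, (k - m = Negz j.+1)%R by exists `|m - k|.-2%N; lia.
apply: (NY f j.+1) => //; exists (ypart w ++ xword (m - base w)), [::].
by rewrite ej -cats1 -!catA.
Qed.

Lemma st_rcons u a : st (rcons u a) = act (st u) a.
Proof. by rewrite -cats1 /st acts_cat. Qed.

(** In a word of N every [y] or [y^-1] is inserted without hopping or cancelling, and no power of
    [x] is ever shortened, so the state records the word letter by letter. *)
Lemma inN_nfword u : inN u -> u = nfword (st u).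
Proof.
elim/last_ind: u => [|u a IH] // uN.
have := IH (inN_rcons uN); have := reduced_st u; rewrite st_rcons.
case: (st u) => w k /= rw eu.
have y e : a = yeps e -> rcons u a = nfword (act (w, k) a).
  move=> ea; rewrite ea eu in uN *.
  by rewrite act_yeps /= ins_reduced ?nfword_yeps // reduced_inN_nfword.
case: a uN y => uN y; [| | exact: y true _ | exact: y false _].
  rewrite eu /nfword /= addrAC; case: (xwordB1 (k - base w)) => ex.
    by rewrite ex rcons_cat.
  rewrite eu /nfword /= ex -rcons_cat in uN.
  by case: (@inN_rcons_linv _ _ uN).
rewrite eu /nfword /= addrAC; case: (xwordD1 (k - base w)) => ex.
  by rewrite ex rcons_cat.
rewrite eu /nfword /= ex -rcons_cat in uN.
by case: (@inN_rcons_linv _ _ uN).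
Qed.

Lemma inN_st_inj u v : inN u -> inN v -> st u = st v -> u = v.
Proof. by move=> uN vN e; rewrite (inN_nfword uN) (inN_nfword vN) e. Qed.

Lemma inN_yeps u e : inN (rcons u (yeps e)) -> reduced (((st u).2, e) :: (st u).1).
Proof.
move=> uN; apply: reduced_inN_nfword (reduced_st u) _.
by rewrite -surjective_pairing -(inN_nfword (inN_rcons uN)).
Qed.

(** * An automaton for N *)

(* [gap u] is [None] unless [u] ends in [y ^ e x ^ i] with [i >= 0]; then it is
   [Some None], [Some (Some false)] or [Some (Some true)], according to
   [i = 0], [i = 1] or [i >= 2]. *)
Definition gaptype : finType := option (option bool).

Definition gap_step (g : gaptype) (a : letter) : gaptype :=
  match a with
  | lx => omap (fun o => Some (isSome o)) g
  | lX => None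
  | _ => Some None
  end.

Definition gap (u : seq letter) : gaptype := foldl gap_step None u.

Definition last_letter (u : seq letter) : option letter :=
  foldl (fun _ a => Some a) None u.

Definition extends (l : option letter) (g : gaptype) (a : letter) : bool :=
  (l != Some (linv a)) &&
  match a with
  | ly => if g is Some (Some _) then false else true
  | lY => if g is Some (Some true) then false else true
  | _ => true
  end.

Definition nstate : finType := (bool * (option letter * gaptype))%type.

Definition nstep (q : nstate) (a : letter) : nstate :=
  (q.1 && extends q.2.1 q.2.2 a, (Some a, gap_step q.2.2 a)).

Definition nrun (u : seq letter) : nstate := foldl nstep (true, (None, None)) u.

Lemma gap_rcons u a : gap (rcons u a) = gap_step (gap u) a.
Proof. exact: foldl_rcons. Qed.

Lemma last_letter_rcons u a : last_letter (rcons u a) = Some a.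
Proof. exact: foldl_rcons. Qed.

Lemma last_letterP u a : last_letter u = Some a -> exists p, u = rcons p a.
Proof.
by case/lastP: u => // p b; rewrite last_letter_rcons => -[->]; exists p.
Qed.

Lemma gap_xpow p e i : gap (p ++ yeps e :: xpow i) =
  match i with 0 => Some None | 1 => Some (Some false) | _ => Some (Some true) end.
Proof.
have -> : gap (p ++ yeps e :: xpow i) = foldl gap_step (Some None) (xpow i).
  by rewrite /gap foldl_cat /=; case: e.
by elim: i => // i; rewrite /xpow -rcons_nseq foldl_rcons => ->; case: i => [|[]].
Qed.

Lemma gapP u g : gap u = Some g -> exists p e i,
  u = p ++ yeps e :: xpow i /\
  match g with None => i = 0 | Some false => i = 1 | Some true => 1 < i end%N.
Proof.
elim/last_ind: u g => // u a IH g; rewrite gap_rcons.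
case: a => //= [|[<-]|[<-]].
- case eg: (gap u) => [h|] //= -[<-].
  have [p [e [i [-> hi]]]] := IH _ eg; exists p, e, i.+1; split.
    by rewrite rcons_cat rcons_cons rcons_nseq.
  by case: h hi {eg} => [[]|] /= => [/ltnW| -> | ->].
- by exists u, true, 0%N; rewrite cats1.
- by exists u, false, 0%N; rewrite cats1.
Qed.

Lemma subword_rcons s b u a : subword (rcons s b) (rcons u a) ->
  subword (rcons s b) u \/ a = b /\ exists p, u = p ++ s.
Proof.
case=> p [q]; case/lastP: q => [|q c].
  by rewrite cats0 -rcons_cat => /rcons_inj[-> ->]; right; split=> //; exists p.
by rewrite -!rcons_cat => /rcons_inj[-> _]; left; exists p, q.
Qed.

Lemma inN_extend u a :
  inN (rcons u a) <-> inN u /\ extends (last_letter u) (gap u) a.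
Proof.
split=> [uN|[uN /andP[/eqP la ga]]].
  split; first exact: inN_rcons uN.
  apply/andP; split.
    apply/eqP=> /last_letterP[p eu]; case: uN => N _.
    apply: (N (linv a)); exists p, [::]; rewrite eu -!cats1 -catA.
    by case: (a).
  case: uN => _ [Ny NY]; case: a Ny NY => // Ny NY.
    case eg: (gap u) => [[b|]|] //; have [p [e [i [eu hi]]]] := gapP eg.
    case: (Ny e i); first by case: b hi {eg}; lia.
    by exists p, [::]; rewrite eu -cats1 -!catA.
  case eg: (gap u) => [[[]|]|] //; have [p [e [[|i] [eu hi]]]] := gapP eg => //.
  by case: (NY e i) => //; exists p, [::]; rewrite eu -cats1 -!catA.
case: (uN) => N [Ny NY]; split=> [b|]; last split=> e i i0.
- rewrite -[[:: _; _]]/(rcons [:: b] (linv b)) => /subword_rcons[/N //|].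
  case=> ea [p eu]; apply: la; rewrite eu cats1 last_letter_rcons ea.
  by case: (b).
- rewrite catA cats1 => /subword_rcons[|[ea [p eu]]].
    by rewrite -cats1 -catA => /(Ny _ _ i0).
  by move: ga; rewrite ea eu gap_xpow; case: i i0 {eu} => [|[]].
- rewrite catA cats1 => /subword_rcons[|[ea [p eu]]].
    by rewrite -cats1 -catA => /(NY _ _ i0).
  by move: ga; rewrite ea eu gap_xpow; case: i i0 {eu} => [|[]].
Qed.

Lemma nrun_rcons u a : nrun (rcons u a) = nstep (nrun u) a.
Proof. exact: foldl_rcons. Qed.

Lemma nrun2E u : (nrun u).2 = (last_letter u, gap u).
Proof.
by elim/last_ind: u => // u a IH; rewrite nrun_rcons /= last_letter_rcons gap_rcons IH.
Qed.

Lemma inNP u : reflect (inN u) (nrun u).1.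
Proof.
elim/last_ind: u => [|u a IH].
  by apply: ReflectT; split=> [a|]; last split=> [e i _|e i _]; case=> -[|? ?] [? //].
rewrite nrun_rcons /= nrun2E /=; apply: (iffP andP).
  by case=> /IH uN ga; apply/inN_extend.
by move=> /inN_extend[/IH].
Qed.

Lemma gap_None u : inN u -> gap u = None ->
  (exists j, u = xpow j) \/ exists p, u = rcons p lX.
Proof.
elim/last_ind: u => [_ _|u a IH uN]; first by left; exists 0%N.
rewrite gap_rcons; case: a uN => //= uN; last by right; exists u.
case eg: (gap u) => // _; case: (IH (inN_rcons uN) eg) => [[j ->]|[p eu]].
  by left; exists j.+1; rewrite rcons_nseq.
by rewrite eu in uN; case: (@inN_rcons_linv p lX).
Qed.

(** In a word of N a final run of [x] cannot follow [x^-1], so it either starts the word or follows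
    [y] or [y^-1]; a [y] occurring anywhere before it excludes the former. *)
Lemma AyAx2_gap u : inN u -> in_AyAx2 u <-> gap u = Some (Some true).
Proof.
move=> uN; split=> [[w1 [w2 [e eu]]]|/gapP[p [e [[|[|i]] [-> hi]]]] //]; last first.
  exists p, (xpow i), e; rewrite /= -[lx :: _]/(xpow i.+2).
  by rewrite -addn2 /xpow nseqD.
set v := w1 ++ [:: yeps e] ++ w2 in eu.
have {}eu : u = rcons (rcons v lx) lx by rewrite eu /v -!cats1 -!catA.
have vxN : inN (rcons v lx) by apply: (@inN_rcons _ lx); rewrite -eu.
have vN := inN_rcons vxN.
rewrite eu !gap_rcons.
case eg: (gap v) => [g|] //=; case: (gap_None vN eg) => [[j ev]|[p ev]].
  have : yeps e \in v by rewrite /v mem_cat inE eqxx orbT.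
  by rewrite ev mem_nseq => /andP[_]; case: e {eu eg ev v vxN vN} => /eqP.
by rewrite ev in vxN; case: (@inN_rcons_linv p lX).
Qed.

(** * Weights *)

(** Gap 3 lets [z_{k+1}^-1] hop over [d]. The three insertions then pay 4, 2 and 4 less for [d],
    which outweighs the possible extra 1 of [effort_conj_mid]. *)
Lemma effort_gap w d (k : int) : reduced (d :: w) -> k + 3 <= d.1 ->
  let W := d :: w in
  [/\ (effort W ((k + 1)%R, false) < effort W (k, true))%N,
      (effort (ins W ((k + 1)%R, false)) (k, true) < effort W (k, true))%N &
      (effort (ins (ins W ((k + 1)%R, false)) (k, true)) ((k + 2)%R, true)
         < effort W (k, true))%N].
Proof.
case: d => m e /reduced_behead rw /= km.
have h1 : hops (k, true) (m, e) by zlia.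
have h2 : hops (k + 1, false) (m, e) by zlia.
have h3 : hops (k, true) (m - 1, e) by zlia.
have h4 : hops (k + 2, true) (m - 1 + 1, e) by zlia.
rewrite h1 h2 /= h3 /= h4.
have /= := effort_conj_inv w k; have /= := effort_conj_mid w k.
by have /= := effort_conj_last k rw; split; lia.
Qed.

(** Gap 4 lets [z_{k+2}^-1] hop over [d]; the savings on [d] are again 4, 2 and 4. *)
Lemma effort_gapV w d (k : int) : reduced (d :: w) -> k + 4 <= d.1 ->
  let W := d :: w in
  [/\ (effort W ((k + 2)%R, false) < effort W (k, false))%N,
      (effort (ins W ((k + 2)%R, false)) (k, false) < effort W (k, false))%N &
      (effort (ins (ins W ((k + 2)%R, false)) (k, false)) ((k + 1)%R, true)
         < effort W (k, false))%N].
Proof.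
case: d => m e /reduced_behead rw /= km.
have h1 : hops (k, false) (m, e) by zlia.
have h2 : hops (k + 2, false) (m, e) by zlia.
have h3 : hops (k, false) (m - 1, e) by zlia.
have h4 : hops (k + 1, true) (m - 1 - 1, e) by zlia.
rewrite h1 h2 /= h3 /= h4.
have /= := effort_conjV_inv w k; have /= := effort_conjV_mid w k.
by have /= := effort_conjV_last k rw; split; lia.
Qed.

Definition cost (s : state) (a : letter) : nat :=
  match a with
  | ly => 16 ^ effort s.1 (s.2, true)
  | lY => 16 ^ effort s.1 (s.2, false)
  | _ => 1
  end.

Fixpoint weight (s : state) (u : seq letter) : nat :=
  if u is a :: v then cost s a + weight (act s a) v else 0%N.

Lemma weight_cat s u v : weight s (u ++ v) = (weight s u + weight (acts s u) v)%N.
Proof. by elim: u s => //= a u IH s; rewrite IH addnA. Qed.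

Lemma cost_gt0 s a : (0 < cost s a)%N.
Proof. by case: a => //=; rewrite expn_gt0. Qed.

Lemma cost_yeps s e : cost s (yeps e) = (16 ^ effort s.1 (s.2, e))%N.
Proof. by case: e. Qed.

Lemma expn16_lt m n : (m < n -> 16 * 16 ^ m <= 16 ^ n)%N.
Proof. by move=> mn; rewrite -expnS leq_exp2l. Qed.

Lemma expn16_add n i : (0 < i -> 16 * 16 ^ n <= 16 ^ (i + n))%N.
Proof. by move=> i0; rewrite expn16_lt // -add1n leq_add2r. Qed.

(** On the right-hand side the moved [y] no longer hops over [z_k^e], which divides its cost by at
    least 16. The letter [y^e] is pushed without hopping, at cost 1, and the factor 16 leaves room
    for the added powers of [x]. *)
Lemma weight_yy w (k : int) e i : reduced ((k, e) :: w) -> (i == 1%N) || (i == 2%N) ->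
  (weight (w, k) (xpow i ++ [:: ly] ++ Xpow i.+1 ++ [:: yeps e] ++ xpow i.+1)
     < weight (w, k) ([:: yeps e] ++ xpow i ++ [:: ly]))%N.
Proof.
move=> rw /orP[]/eqP -> {i}.
  have h : hops (k - 1, true) (k, e) by zlia.
  have := effort_reduced (reduced_ins_cons rw h); rewrite /zconj /=.
  have gt0 : (0 < 16 ^ effort w ((k - 1)%R, true))%N by rewrite expn_gt0.
  rewrite !cost_yeps !act_yeps /= (ins_reduced rw) /= h !subrK => r.
  rewrite r expn0.
  have -> : absz (k - (k - 1))%R = 1%N by lia.
  move: (@expn16_add (effort w ((k - 1)%R, true)) (1 * 2 - 1)%N isT) gt0.
  by move: (16 ^ (_ + effort w _))%N (16 ^ (effort w ((k - 1)%R, true)))%N => Y X; lia.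
have h : hops (k - 1 - 1, true) (k, e) by zlia.
have := effort_reduced (reduced_ins_cons rw h); rewrite /zconj /=.
have gt0 : (0 < 16 ^ effort w ((k - 1 - 1)%R, true))%N by rewrite expn_gt0.
rewrite !cost_yeps !act_yeps /= (ins_reduced rw) /= h !subrK => r.
rewrite r expn0.
have -> : absz (k - (k - 1 - 1))%R = 2%N by lia.
move: (@expn16_add (effort w ((k - 1 - 1)%R, true)) (2 * 2 - 1)%N isT) gt0.
by move: (16 ^ (_ + effort w _))%N (16 ^ (effort w ((k - 1 - 1)%R, true)))%N => Y X; lia.
Qed.

Lemma weight_yY w (k : int) e i : reduced ((k, e) :: w) -> (i == 2%N) || (i == 3%N) ->
  (weight (w, k) (xpow i ++ [:: lY] ++ Xpow i.-1 ++ [:: yeps e] ++ xpow i.-1)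
     < weight (w, k) ([:: yeps e] ++ xpow i ++ [:: lY]))%N.
Proof.
move=> rw /orP[]/eqP -> {i}.
  have h : hops (k - 1 - 1, false) (k, e) by zlia.
  have := effort_reduced (reduced_ins_cons rw h); rewrite /zconj /=.
  have gt0 : (0 < 16 ^ effort w ((k - 1 - 1)%R, false))%N by rewrite expn_gt0.
  rewrite !cost_yeps !act_yeps /= (ins_reduced rw) /= h !subrK => r.
  rewrite r expn0.
  have -> : absz (k - (k - 1 - 1))%R = 2%N by lia.
  move: (@expn16_add (effort w ((k - 1 - 1)%R, false)) (2 * 2 - 3)%N isT) gt0.
  by move: (16 ^ (_ + effort w _))%N (16 ^ (effort w ((k - 1 - 1)%R, false)))%N => Y X; lia.
have h : hops (k - 1 - 1 - 1, false) (k, e) by zlia.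
have := effort_reduced (reduced_ins_cons rw h); rewrite /zconj /=.
have gt0 : (0 < 16 ^ effort w ((k - 1 - 1 - 1)%R, false))%N by rewrite expn_gt0.
rewrite !cost_yeps !act_yeps /= (ins_reduced rw) /= h !subrK => r.
rewrite r expn0.
have -> : absz (k - (k - 1 - 1 - 1))%R = 3%N by lia.
move: (@expn16_add (effort w ((k - 1 - 1 - 1)%R, false)) (3 * 2 - 3)%N isT) gt0.
by move: (16 ^ (_ + effort w _))%N (16 ^ (effort w ((k - 1 - 1 - 1)%R, false)))%N => Y X; lia.
Qed.

Lemma weight_xy w d (k : int) : reduced (d :: w) -> k + 2 <= d.1 ->
  (weight (d :: w, k) ([:: lY; lx; ly] ++ Xpow 2 ++ [:: ly] ++ xpow 2)
     < weight (d :: w, k) [:: lx; ly])%N.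
Proof.
(* The [x] of the left-hand side lowers the index of the inserted letter, so gap 2 becomes gap 3. *)
move=> rw kd; have kd' : (k - 1) + 3 <= d.1 by lia.
have [] := effort_gap rw kd'; rewrite [weight _ (_ ++ _)]/= subrK.
have -> : k - 1 + 2 = k + 1 by lia.
set W := d :: w; rewrite /= -/W.
move=> /expn16_lt h1 /expn16_lt h2 /expn16_lt h3.
by move: h1 h2 h3 (cost_gt0 (W, k) lY) => /=; lia.
Qed.

Lemma weight_xxY w d (k : int) : reduced (d :: w) -> k + 2 <= d.1 ->
  (weight (d :: w, k) ([:: lY] ++ xpow 2 ++ [:: lY; lX; ly; lx])
     < weight (d :: w, k) (xpow 2 ++ [:: lY]))%N.
Proof.
move=> rw kd; have kd' : (k - 1 - 1) + 4 <= d.1 by lia.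
have [] := effort_gapV rw kd'; rewrite [weight _ (_ ++ _)]/=.
have -> : k - 1 - 1 + 2 = k by lia.
set W := d :: w; rewrite /= -/W.
move=> /expn16_lt h1 /expn16_lt h2 /expn16_lt h3.
by move: h1 h2 h3 (cost_gt0 (W, k) lY) => /=; lia.
Qed.

(** * The rules hold in F *)

Section Congruence.
Variables (B : Type) (r : seq B -> seq B -> Prop).

Lemma congr_refl u : congr r u u. Proof. exact: rst_refl. Qed.

Lemma congr_sym u v : congr r u v -> congr r v u. Proof. exact: rst_sym. Qed.

Lemma congr_trans v u w : congr r u v -> congr r v w -> congr r u w.
Proof. exact: rst_trans. Qed.

Lemma congr_rel p q u v : r u v -> congr r (p ++ u ++ q) (p ++ v ++ q).
Proof. by move=> ruv; apply: rst_step; exists p, q, u, v. Qed.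

Lemma congr_context p q u v : congr r u v -> congr r (p ++ u ++ q) (p ++ v ++ q).
Proof.
elim=> {u v} [_ _ [p' [q' [u [v [ruv [-> ->]]]]]]|u|u v _|u v w _ + _].
- by have := congr_rel (p ++ p') (q' ++ q) ruv; rewrite -!catA.
- exact: congr_refl.
- exact: congr_sym.
- exact: congr_trans.
Qed.

End Congruence.

(** A direct match lets [freduce] be evaluated on closed words; the equality test of [letter] passes
    through [inord]. *)
Definition cancels (a b : letter) : bool :=
  match a, b with
  | lx, lX | lX, lx | ly, lY | lY, ly => true
  | _, _ => false
  end.

Fixpoint freduce (u : seq letter) : seq letter :=
  if u is a :: v then
    if freduce v is b :: v' then if cancels a b then v' else a :: b :: v'
    else [:: a]
  else [::].

Lemma Feq_freduce u : Feq u (freduce u).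
Proof.
elim: u => [|a u IH] /=; first exact: congr_refl.
apply: (@congr_trans _ _ (a :: freduce u)).
  by have := congr_context [:: a] [::] IH; rewrite !cats0.
case: (freduce u) => [|b v]; first exact: congr_refl.
case ab: (cancels a b); last exact: congr_refl.
have -> : b = linv a by case: a b ab => [] [].
by apply: (@congr_rel _ _ [::] v [:: a; linv a] [::]); split=> //; left; exists a.
Qed.

(** Reduces an equation in F to the place where a relator is inserted: for closed words both
    free-reduction hypotheses are checked by evaluation. *)
Lemma Feq_relator p q rel u v : F_rel rel [::] ->
  freduce (p ++ q) = freduce u -> freduce (p ++ rel ++ q) = freduce v -> Feq u v.
Proof.
move=> hr eu ev.
apply: congr_trans (Feq_freduce u) _; rewrite -eu.
apply: congr_trans (congr_sym (Feq_freduce _)) _.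
apply: congr_sym; apply: congr_trans (Feq_freduce v) _; rewrite -ev.
apply: congr_trans (congr_sym (Feq_freduce _)) _.
exact: (congr_rel p q hr).
Qed.

Lemma F_rel1 : F_rel relator1 [::].
Proof. by split=> //; right; left. Qed.

Lemma F_rel2 : F_rel relator2 [::].
Proof. by split=> //; right; right. Qed.

(* [y ^ e] commutes with [a = x y x^-2] and [b = x^2 y x^-3]; each case below
   inserts a relator [y^-1 a^-1 y a] or [y^-1 b^-1 y b] into one of the sides. *)
Lemma Feq_R_F l r : R_F l r -> Feq l r.
Proof.
have ctx u l' r' : Feq l' r' -> Feq (u ++ l') (u ++ r').
  by move=> /(congr_context u [::]); rewrite !cats0.
pose a := [:: lx; ly; lX; lX]; pose b := [:: lx; lx; ly; lX; lX; lX].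
case=> [[u [c [-> ->]]]|].
  rewrite -{2}[u]cats0; apply: ctx.
  by apply: (@congr_rel _ _ [::] [::] [:: c; linv c] [::]); split=> //; left; exists c.
case=> [[u [e [i [hi [_ [-> ->]]]]]]|].
  apply: ctx; case/orP: hi => /eqP->; case: e.
  - apply: congr_sym; exact: (@Feq_relator (a ++ [:: ly]) (xpow 2) _ _ _ F_rel1).
  - exact: (@Feq_relator (a) (winv a ++ lY :: a ++ xpow 2) _ _ _ F_rel1).
  - apply: congr_sym; exact: (@Feq_relator (b ++ [:: ly]) (xpow 3) _ _ _ F_rel2).
  - exact: (@Feq_relator (b) (winv b ++ lY :: b ++ xpow 3) _ _ _ F_rel2).
case=> [[u [e [i [hi [_ [-> ->]]]]]]|].
  apply: ctx; case/orP: hi => /eqP->; case: e.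
  - exact: (@Feq_relator ([:: ly]) (winv a ++ xpow 1) _ _ _ F_rel1).
  - apply: congr_sym; exact: (@Feq_relator ([::]) (winv a ++ lY :: xpow 1) _ _ _ F_rel1).
  - exact: (@Feq_relator ([:: ly]) (winv b ++ xpow 2) _ _ _ F_rel2).
  - apply: congr_sym; exact: (@Feq_relator ([::]) (winv b ++ lY :: xpow 2) _ _ _ F_rel2).
case=> [[u [_ [_ [-> ->]]]]|[u [_ [_ [-> ->]]]]]; apply: ctx.
- apply: congr_sym; exact: (@Feq_relator (lY :: a ++ [:: ly]) (xpow 2) _ _ _ F_rel1).
- exact: (@Feq_relator ([::]) (winv a ++ xpow 1) _ _ _ F_rel1).
Qed.

(** * Convergence *)

Lemma st_AyAx2 u : inN u -> in_AyAx2 u ->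
  exists d w, (st u).1 = d :: w /\ (st u).2 + 2 <= d.1.
Proof.
move=> uN /(AyAx2_gap uN)/gapP[p [e [i [eu i2]]]].
have pN : inN (rcons p (yeps e)).
  by apply: (@inN_cat _ (xpow i)); rewrite cat_rcons -eu.
rewrite eu -cat_rcons {1 2}/st acts_cat -/(st (rcons p (yeps e))) st_rcons.
rewrite acts_xpow act_yeps /= (ins_reduced (inN_yeps pN)).
by exists ((st p).2, e), (st p).1; split=> //=; lia.
Qed.

Lemma weight_R_F l r : R_F l r -> (weight origin r < weight origin l)%N.
Proof.
have yred u e i : inN (u ++ [:: yeps e] ++ xpow i) ->
    reduced (((st u).2, e) :: (st u).1).
  by rewrite catA cats1 => /inN_cat; exact: inN_yeps.
case=> [[u [a [-> ->]]]|].
  by rewrite weight_cat -[ltnLHS]addn0 ltn_add2l /= addn_gt0 cost_gt0.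
case=> [[u [e [i [hi [/yred red [-> ->]]]]]]|].
  rewrite (weight_cat _ u) [ltnRHS](weight_cat _ u) ltn_add2l -/(st u).
  by rewrite [st u]surjective_pairing weight_yy.
case=> [[u [e [i [hi [/yred red [-> ->]]]]]]|].
  rewrite (weight_cat _ u) [ltnRHS](weight_cat _ u) ltn_add2l -/(st u).
  by rewrite [st u]surjective_pairing weight_yY.
case=> [] [u [uN [/(st_AyAx2 uN)[d [w [ew hk]]] [-> ->]]]].
  rewrite (weight_cat _ u) [ltnRHS](weight_cat _ u) ltn_add2l -/(st u).
  have := reduced_st u; rewrite [st u]surjective_pairing ew => red.
  exact: weight_xy.
rewrite (weight_cat _ u) [ltnRHS](weight_cat _ u) ltn_add2l -/(st u).
have := reduced_st u; rewrite [st u]surjective_pairing ew => red.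
exact: weight_xxY.
Qed.

(** The two sides of a rule are equal in F, so they lead to the same state, and the untouched suffix
    has the same weight after either. *)
Lemma weight_prewrite u v : prewrite R_F u v ->
  (weight origin v < weight origin u)%N.
Proof.
case=> l [r [z [lr [-> ->]]]]; rewrite !weight_cat.
by rewrite -/(st r) -/(st l) (st_Feq (Feq_R_F lr)) ltn_add2r weight_R_F.
Qed.

Lemma terminating_R_F : terminating R_F.
Proof.
case=> f f_step.
have decr n : (weight origin (f n) + n <= weight origin (f 0))%N.
  by elim: n => [|n IH]; rewrite ?addn0 //; have := weight_prewrite (f_step n); lia.
by have := decr (weight origin (f 0%N)).+1; lia.
Qed.

Lemma cat_xpow p e i j s :
  (p ++ yeps e :: xpow i) ++ xpow j ++ s = p ++ [:: yeps e] ++ xpow (j + i) ++ s.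
Proof. by rewrite -catA cat_cons catA -nseqD addnC. Qed.

Lemma R_F_left_not_inN l r : R_F l r -> ~ inN l.
Proof.
case=> [[u [a [-> _]]] lN|].
  by case: (@inN_rcons_linv u a); rewrite -!cats1 -catA.
have long u : inN u -> in_AyAx2 u -> exists p e i, u = p ++ yeps e :: xpow i.+2.
  by move=> uN /(AyAx2_gap uN)/gapP[p [e [[|[|i]] [-> //]]]]; exists p, e, i.
case=> [[u [e [i [hi [_ [-> _]]]]]] [_ [Ny _]]|].
  by apply: (Ny e i); [case/orP: hi => /eqP-> | exists u, [::]; rewrite cats0].
case=> [[u [e [i [hi [_ [-> _]]]]]] [_ [_ NY]]|].
  apply: (NY e i.-1); first by case/orP: hi => /eqP->.
  by exists u, [::]; rewrite cats0; case/orP: hi => /eqP->.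
case=> [] [u [uN [/(long _ uN)[p [e [i ->]]] [-> _]]]] [_ [Ny NY]].
  apply: (Ny e i.+3) => //; exists p, [::].
  by rewrite cats0; exact: (cat_xpow p e i.+2 1 [:: ly]).
apply: (NY e i.+3) => //; exists p, [::].
by rewrite cats0; exact: (cat_xpow p e i.+2 2 [:: lY]).
Qed.

Lemma prewrite_cat z u v : prewrite R_F u v -> prewrite R_F (u ++ z) (v ++ z).
Proof.
by case=> l [r [y [lr [-> ->]]]]; exists l, r, (y ++ z); rewrite !catA.
Qed.

Lemma prewrite_rule l r : R_F l r -> prewrite R_F l r.
Proof. by move=> lr; exists l, r, [::]; rewrite !cats0. Qed.

Lemma in_AyAx2_xpow p e i : in_AyAx2 (p ++ yeps e :: xpow i.+2).
Proof. by exists p, (xpow i), e; rewrite -addn2 /xpow nseqD. Qed.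

(** Take the shortest prefix outside N: its last letter cancels its predecessor or completes
    [y^e x^i y] or [y^e x^i y^-1]. The exponent [i] selects the rule. *)
Lemma prewrite_not_inN u : ~ inN u -> exists v, prewrite R_F u v.
Proof.
elim/last_ind: u => [|u a IH] uaN.
  by case: uaN; apply/inNP.
case: (inNP u) => uN; last first.
  by have [v uv] := IH uN; exists (v ++ [:: a]); rewrite -cats1; exact: prewrite_cat.
have rule r : R_F (rcons u a) r -> exists v, prewrite R_F (rcons u a) v.
  by move=> lr; exists r; exact: prewrite_rule.
case: (last_letter u =P Some (linv a)) => [/last_letterP[p eu]|la].
  apply: (rule p); left; exists p, (linv a).
  by rewrite eu -!cats1 -catA; case: (a).
have: ~~ extends (last_letter u) (gap u) a.
  by apply/negP => ext; apply: uaN; apply/inN_extend.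
rewrite negb_and negbK; move/eqP/negPf: (la) => -> /=.
have cut p e i j : u = p ++ yeps e :: xpow (i + j) -> inN (p ++ yeps e :: xpow i).
  move=> eu; apply: (@inN_cat _ (xpow j)).
  by rewrite -catA cat_cons -nseqD -eu.
case: a rule {uaN la} => //= rule.
  case eg: (gap u) => [[b|]|] // _; have [p [e [i [eu hi]]]] := gapP eg.
  have : (0 < i)%N by case: b hi {eg} => [|->//]; lia.
  case: i eu {hi} => [|[|[|i]]] // eu _.
  - apply: rule; right; left; exists p, e, 1%N.
    by split=> //; split; [rewrite -eu | rewrite eu -cats1 -catA].
  - apply: rule; right; left; exists p, e, 2%N.
    by split=> //; split; [rewrite -eu | rewrite eu -cats1 -catA].
  (* The exponent is at least 3: one [x] goes into the rule and at least [x^2] remains in its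
     prefix. *)
  apply: rule; right; right; right; left; exists (p ++ yeps e :: xpow i.+2).
  split; first by apply: (cut _ _ _ 1%N); rewrite eu addn1.
  split; first exact: in_AyAx2_xpow.
  split; last by [].
  by rewrite eu -cats1 -catA; exact/esym/(cat_xpow p e i.+2 1 [:: ly]).
case eg: (gap u) => [[[]|]|] // _; have [p [e [i [eu i2]]]] := gapP eg.
case: i eu i2 => [|[|[|[|i]]]] // eu _.
- apply: rule; right; right; left; exists p, e, 2%N.
  by split=> //; split; [rewrite -eu | rewrite eu -cats1 -catA].
- apply: rule; right; right; left; exists p, e, 3%N.
  by split=> //; split; [rewrite -eu | rewrite eu -cats1 -catA].
(* The exponent is at least 4: the rule takes [x^2] and again at least [x^2] remains. *)
apply: rule; right; right; right; right; exists (p ++ yeps e :: xpow i.+2).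
split; first by apply: (cut _ _ _ 2%N); rewrite eu addn2.
split; first exact: in_AyAx2_xpow.
split; last by [].
by rewrite eu -cats1 -catA; exact/esym/(cat_xpow p e i.+2 2 [:: lY]).
Qed.

Lemma irreducible_inN u : irreducible R_F u <-> inN u.
Proof.
split=> [irr|uN v [l [r [z [lr [eu _]]]]]].
  by case: (inNP u) => // /prewrite_not_inN[v /irr].
by case: (R_F_left_not_inN lr); apply: (@inN_cat _ z); rewrite -eu.
Qed.

Lemma congr_prewrite (B : Type) (r : seq B -> seq B -> Prop) u v :
  prewrite r u v -> congr r u v.
Proof. by case=> l [l' [z [ll' [-> ->]]]]; exact: (congr_rel [::] z ll'). Qed.

Lemma congr_normal_form u : exists v, inN v /\ congr R_F u v.
Proof.
have [n] := ubnP (weight origin u); elim: n u => // n IH u; rewrite ltnS => un.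
case: (inNP u) => [uN|/prewrite_not_inN[v uv]].
  by exists u; split=> //; exact: congr_refl.
have [w [wN vw]] := IH v (leq_trans (weight_prewrite uv) un).
by exists w; split=> //; apply: congr_trans vw; exact: congr_prewrite.
Qed.

Lemma congr_R_F_Feq u v : congr R_F u v <-> Feq u v.
Proof.
have sound u' v' : congr R_F u' v' -> Feq u' v'.
  elim=> {u' v'} [_ _ [p [q [u' [v' [ruv [-> ->]]]]]]|u'|u' v' _|u' v' w _ + _].
  - by apply: congr_context; exact: Feq_R_F.
  - exact: congr_refl.
  - exact: congr_sym.
  - exact: congr_trans.
split=> [|uv]; first exact: sound.
(* Instead of deriving the relators from the rules, both words are rewritten into N, where equality
   in F forces equal states and hence equal words. *)
have [u' [u'N uu']] := congr_normal_form u.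
have [v' [v'N vv']] := congr_normal_form v.
suff eq' : u' = v' by apply: congr_trans uu' _; rewrite eq'; exact: congr_sym.
apply: inN_st_inj => //.
by rewrite -(st_Feq (sound _ _ uu')) -(st_Feq (sound _ _ vv')); exact: st_Feq.
Qed.

Lemma evw_letters u : evw (fun a : letter => [:: a]) u = u.
Proof. exact: flatten_seq1. Qed.

Lemma CPRS_R_F : CPRS_F (fun a : letter => [:: a]) R_F.
Proof.
split; last 1 first.
- move=> g; have [v [vN /congr_R_F_Feq gv]] := congr_normal_form g.
  exists v; rewrite evw_letters; split; first exact/irreducible_inN.
    exact: congr_sym.
  move=> w /irreducible_inN wN; rewrite evw_letters => wg.
  by apply: inN_st_inj => //; apply: st_Feq; exact: congr_trans wg gv.
- split=> [g|u v]; last by rewrite !evw_letters; exact: congr_R_F_Feq.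
  by exists g; rewrite evw_letters; exact: congr_refl.
- exact: terminating_R_F.
Qed.

Lemma bounded_R_F : bounded_rs R_F.
Proof.
(* The longest rules, ending in [y^e x^2 y] and [y^e x^3 y^-1], have total length 14 beyond the
   common prefix. *)
exists 16%N => l r.
case=> [[u [a [-> ->]]]|].
  by exists u, [:: a; linv a], [::]; rewrite cats0.
case=> [[u [e [i [hi [_ [-> ->]]]]]]|].
  by do 3!eexists; do 2!split=> //; case/orP: hi => /eqP->.
case=> [[u [e [i [hi [_ [-> ->]]]]]]|].
  by do 3!eexists; do 2!split=> //; case/orP: hi => /eqP->.
by case=> [] [u [_ [_ [-> ->]]]]; do 3!eexists; do 2!split=> //.
Qed.

(** * Regularity *)

Definition regular (S : Type) (P : seq S -> Prop) : Prop :=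
  exists D : dfa S, forall s, dfa_accepts D s <-> P s.

Lemma regular_ext S (P Q : seq S -> Prop) :
  (forall s, P s <-> Q s) -> regular P -> regular Q.
Proof.
by move=> PQ [D DP]; exists D => s; split=> [/DP/PQ|/PQ/DP].
Qed.

Lemma regular_false S : regular (fun _ : seq S => False).
Proof.
exists (@Dfa S unit tt (fun=> false) (fun=> fun=> tt)) => s.
by rewrite /dfa_accepts.
Qed.

Lemma regular_or S (P Q : seq S -> Prop) :
  regular P -> regular Q -> regular (fun s => P s \/ Q s).
Proof.
move=> [D DP] [E EQ].
pose step (q : dfa_state D * dfa_state E) c := (dfa_trans q.1 c, dfa_trans q.2 c).
pose DE := @Dfa S _ (dfa_start D, dfa_start E)
             (fun q => dfa_final q.1 || dfa_final q.2) step.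
exists DE => s.
have -> : dfa_accepts DE s = dfa_accepts D s || dfa_accepts E s.
  rewrite /dfa_accepts /=.
  by elim: s (dfa_start D) (dfa_start E) => //= c s IH q q'; rewrite IH.
split=> [/orP[/DP|/EQ]|[/DP|/EQ]]; [by left | by right | | ] => -> //.
by rewrite orbT.
Qed.

(** The added bit says that the last letter read was [c] and that the word before it was
    accepted. *)
Lemma regular_rcons (S : eqType) (P : seq S -> Prop) c :
  regular P -> regular (fun s => exists2 t, P t & s = rcons t c).
Proof.
move=> [D DP].
pose step (q : dfa_state D * bool) d := (dfa_trans q.1 d, (d == c) && dfa_final q.1).
exists (@Dfa S _ (dfa_start D, false) snd step) => s.
have run1 t : (foldl step (dfa_start D, false) t).1 = foldl (@dfa_trans _ D) (dfa_start D) t.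
  by elim/last_ind: t => // t d IH; rewrite !foldl_rcons /= IH.
rewrite /dfa_accepts /=; case/lastP: s => [|t d].
  by split=> // -[[|? ?] _].
rewrite foldl_rcons /= run1 -/(dfa_accepts D t).
by split=> [/andP[/eqP-> /DP Pt]|[t' /DP Pt /rcons_inj[-> ->]]]; [exists t | rewrite eqxx].
Qed.

Lemma regular_cat (S : eqType) (P : seq S -> Prop) t :
  regular P -> regular (fun s => exists2 u, P u & s = u ++ t).
Proof.
elim: t P => [|c t IH] P rP.
  apply: regular_ext rP => s; split=> [Ps|[u Pu ->]]; last by rewrite cats0.
  by exists s; rewrite ?cats0.
apply: regular_ext (IH _ (regular_rcons c rP)) => s.
split=> [[_ [u Pu ->] ->]|[u Pu ->]]; first by exists u; rewrite -?cat_rcons.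
by exists (rcons u c); [exists u | rewrite cat_rcons].
Qed.

Lemma regular_diag (A Q : finType) (q0 : Q) (step : Q -> A -> Q) (f : pred Q) :
  regular (fun s => exists2 u, f (foldl step q0 u) & s = [seq (Some a, Some a) | a <- u]).
Proof.
(* [None] is a sink, entered when the two tracks differ or a padding symbol is read. *)
pose dstep (o : option Q) (c : option A * option A) : option Q :=
  match o, c with
  | Some q, (Some a, Some b) => if a == b then Some (step q a) else None
  | _, _ => None
  end.
exists (@Dfa _ _ (Some q0) (fun o => if o is Some q then f q else false) dstep) => s.
have none t : foldl dstep None t = None by elim: t.
rewrite /dfa_accepts /=; elim: s q0 => [|c s IH] q /=.
  by split=> [fq|[[|? ?]] //]; exists [::].
case: c => [[a|] [b|]] /=; rewrite ?none; try by split=> // -[[|? ?]].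
case: eqP => [<-|ab]; last first.
  by rewrite none; split=> // -[[|? ?] //= _ [] ea /esym eb]; case: ab; rewrite ea eb.
rewrite IH; split=> [[u fu ->]|[[|? u] //= fu [-> _ ->]]]; first by exists (a :: u).
by exists u.
Qed.

Lemma sync_regular_ext B (R R' : seq B -> seq B -> Prop) :
  (forall u v, R u v <-> R' u v) -> sync_regular R -> sync_regular R'.
Proof.
move=> RR'; apply: regular_ext => s.
by split=> -[u [v [/RR' ? ?]]]; exists u, v.
Qed.

Lemma sync_regular_or B (R R' : seq B -> seq B -> Prop) :
  sync_regular R -> sync_regular R' -> sync_regular (fun u v => R u v \/ R' u v).
Proof.
move=> rR rR'; apply: regular_ext (regular_or rR rR') => s.
split=> [[]|] [u [v [uv es]]]; first by exists u, v; split; [left|].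
  by exists u, v; split; [right|].
by case: uv; [left|right]; exists u, v.
Qed.

Lemma sync_regular_exists B (T : eqType) (s : seq T) (R : T -> seq B -> seq B -> Prop) :
  (forall a, sync_regular (R a)) ->
  sync_regular (fun u v => exists2 a, a \in s & R a u v).
Proof.
move=> rR; elim: s => [|a s IH].
  by apply: regular_ext (regular_false _) => s; split=> // -[u [v [[]]]].
apply: sync_regular_ext (sync_regular_or (rR a) IH) => u v.
split=> [[Ra|[b bs Rb]]|[b]].
- by exists a; rewrite ?mem_head.
- by exists b; rewrite // inE bs orbT.
- by rewrite inE => /orP[/eqP->|bs] Rb; [left | right; exists b].
Qed.

Lemma pad_cat B (u l r : seq B) :
  pad (u ++ l) (u ++ r) = [seq (Some a, Some a) | a <- u] ++ pad l r.
Proof.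
elim: u => //= a u <-; rewrite /pad /= maxnSS /=; congr (_ :: _).
by rewrite -[1%N]addn0 iotaDl -map_comp.
Qed.

(** R is a finite union of such relations. Padding turns each into a diagonal word over a regular
    set of prefixes followed by one fixed word. *)
Definition prefix_rule (f : pred nstate) (l r u v : seq letter) : Prop :=
  exists2 w, f (nrun w) & u = w ++ l /\ v = w ++ r.

Lemma sync_regular_prefix_rule f l r : sync_regular (prefix_rule f l r).
Proof.
apply: regular_ext (regular_cat (pad l r) (regular_diag (true, (None, None)) nstep f)) => s.
split=> [[_ [w fw ->] ->]|[_ [_ [[w fw [-> ->]] ->]]]].
  by exists (w ++ l), (w ++ r); split; [exists w | rewrite pad_cat].
by exists [seq (Some a, Some a) | a <- w]; [exists w | rewrite pad_cat].
Qed.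

Lemma inN_foldl u v : (foldl nstep (nrun u) v).1 <-> inN (u ++ v).
Proof. by rewrite /nrun -foldl_cat; split=> [/inNP|/inNP]. Qed.

Lemma AyAx2_nrun u :
  (nrun u).1 && ((nrun u).2.2 == Some (Some true)) <-> inN u /\ in_AyAx2 u.
Proof.
rewrite nrun2E /=; split=> [/andP[/inNP uN /eqP/(AyAx2_gap uN)] //|[uN uA]].
by apply/andP; split; [exact/inNP | apply/eqP/AyAx2_gap].
Qed.

Lemma sync_regular_R_F : sync_regular R_F.
Proof.
(* Some rules require a word longer than the common prefix to lie in N; [after v] tests this by
   running the automaton ahead over [v]. *)
pose after v : pred nstate := fun q => (foldl nstep q v).1.
pose steep : pred nstate := fun q => q.1 && (q.2.2 == Some (Some true)).
have reg := (sync_regular_or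
  (sync_regular_exists (enum {: letter}) (fun a =>
    sync_regular_prefix_rule predT [:: a; linv a] [::]))
  (sync_regular_or
  (sync_regular_exists [:: true; false] (fun e =>
    sync_regular_exists [:: 1%N; 2%N] (fun i =>
    sync_regular_prefix_rule (after ([:: yeps e] ++ xpow i))
      ([:: yeps e] ++ xpow i ++ [:: ly])
      (xpow i ++ [:: ly] ++ Xpow i.+1 ++ [:: yeps e] ++ xpow i.+1))))
  (sync_regular_or
  (sync_regular_exists [:: true; false] (fun e =>
    sync_regular_exists [:: 2%N; 3%N] (fun i =>
    sync_regular_prefix_rule (after ([:: yeps e] ++ xpow i))
      ([:: yeps e] ++ xpow i ++ [:: lY])
      (xpow i ++ [:: lY] ++ Xpow i.-1 ++ [:: yeps e] ++ xpow i.-1))))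
  (sync_regular_or
  (sync_regular_prefix_rule steep [:: lx; ly]
    ([:: lY; lx; ly] ++ Xpow 2 ++ [:: ly] ++ xpow 2))
  (sync_regular_prefix_rule steep (xpow 2 ++ [:: lY])
    ([:: lY] ++ xpow 2 ++ [:: lY; lX; ly; lx])))))).
apply: (sync_regular_ext _ reg) => l r.
have ebool e : e \in [:: true; false] by case: e.
split.
  case=> [[a _ [u _ [-> ->]]]|]; first by left; exists u, a; rewrite cats0.
  case=> [[e _ [i hi [u /inN_foldl uN [-> ->]]]]|].
    by right; left; exists u, e, i; move: hi; rewrite !inE.
  case=> [[e _ [i hi [u /inN_foldl uN [-> ->]]]]|].
    by right; right; left; exists u, e, i; move: hi; rewrite !inE.
  by case=> -[u /AyAx2_nrun[uN uA] [-> ->]]; do 3 right; [left | right]; exists u.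
case=> [[u [a [-> ->]]]|]; first by left; exists a; rewrite ?mem_enum //; exists u; rewrite ?cats0.
case=> [[u [e [i [hi [uN [-> ->]]]]]]|].
  right; left; exists e => //; exists i; first by rewrite !inE.
  by exists u; first exact/inN_foldl.
case=> [[u [e [i [hi [uN [-> ->]]]]]]|].
  right; right; left; exists e => //; exists i; first by rewrite !inE.
  by exists u; first exact/inN_foldl.
by case=> [] [u [uN [uA [-> ->]]]]; do 3 right; [left | right]; exists u;
  rewrite //; exact/AyAx2_nrun.
Qed.

Theorem theorem1p1 :
  F_autostackable /\ bounded_regular_CPRS_F (fun a : letter => [:: a]) R_F.
Proof.
suff R_F_ok : bounded_regular_CPRS_F (fun a : letter => [:: a]) R_F.
  by split=> //; exists letter, (fun a => [:: a]), R_F.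
split; [exact: CPRS_R_F | exact: bounded_R_F | exact: sync_regular_R_F].
Qed.
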